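(* Let $p$ be a prime, let $A=\{\mathbf a_1,\dots,\mathbf a_N\}\subseteq\mathbb Z^n$ with $\mathbf a_j=(a_{j1},\dots,a_{jn})$, and let $\beta=(\beta_1,\dots,\beta_n)\in\mathbb Z^n$. Let $S_A(\beta)\subseteq\mathbb F_p((\lambda_1,\dots,\lambda_N))$ be the set of all $G$ annihilated by the operators $Z_i=\sum_{j=1}^N a_{ji}\lambda_j\frac{\partial}{\partial\lambda_j}-\beta_i$ ($i=1,\dots,n$, coefficients read in $\mathbb F_p$) and by the operators $\overline\Box_l$ for all $l\in L$, where $$\overline\Box_l=\begin{cases}\prod_{l_i>0}(\partial/\partial\lambda_i)^{l_i} & \text{if }\sum_i l_i>0,\\ \prod_{l_i<0}(\partial/\partial\lambda_i)^{-l_i} & \text{if }\sum_i l_i<0,\\ \prod_{l_i>0}(\partial/\partial\lambda_i)^{l_i}-\prod_{l_i<0}(\partial/\partial\lambda_i)^{-l_i} & \text{if }\sum_i l_i=0.\end{cases}$$ Then the set of polynomials $\{F_\gamma:\gamma\in\sigma_A(\beta)\}$ is a basis of $S_A(\beta)$ as a vector space over $\mathbb F_p((\lambda_1^p,\dots,\lambda_N^p))$.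
   Context: $\mathbb F_p((\lambda_1,\dots,\lambda_N))$ denotes the fraction field of $\mathbb F_p[[\lambda_1,\dots,\lambda_N]]$. $L=\{l\in\mathbb Z^N:\sum_i l_i\mathbf a_i=\mathbf 0\}$. $\mathbb N=\{0,1,\dots\}$, $\mathbb NA=\{\sum_i c_i\mathbf a_i:c_i\in\mathbb N\}$. For $\gamma\in\mathbb NA$: $U^+(\gamma)=\{u\in\mathbb N^N:\sum_iu_i\mathbf a_i=\gamma\}$, $U^+_{p-1}(\gamma)=\{u\in U^+(\gamma):u_i\le p-1\ \forall i\}$, $w(\gamma)=\min\{\sum_iu_i:u\in U^+(\gamma)\}$, $U^+_{\min}(\gamma)=\{u\in U^+(\gamma):\sum_iu_i=w(\gamma)\}$. $\gamma$ is good if $U^+_{\min}(\gamma)\subseteq U^+_{p-1}(\gamma)$; for good $\gamma$, $F_\gamma(\lambda)=\sum_{u\in U^+_{\min}(\gamma)}\frac{\lambda_1^{u_1}\cdots\lambda_N^{u_N}}{u_1!\cdots u_N!}\in\mathbb F_p[\lambda_1,\dots,\lambda_N]$. Finally $\sigma_A(\beta)=\{\gamma\in(\beta+p\mathbb Z^n)\cap\mathbb NA:\gamma\text{ good}\}$. *)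

(* Defs.v *)
From HB Require Import structures.
From mathcomp Require Import all_boot all_order all_algebra.
From mathcomp Require Import generic_quotient fraction boolp classical_sets.
From mathcomp Require Import mpoly ring.

Set Implicit Arguments.
Unset Strict Implicit.
Unset Printing Implicit Defensive.

Import Order.TTheory GRing.Theory.

Local Open Scope classical_set_scope.
Local Open Scope ring_scope.

(* Formal power series in the n commuting variables indexed by 'I_n. A record
   rather than a bare function type, so that the Cauchy product does not
   compete with pointwise structures on functions. *)
Record mpseries (n : nat) (R : Type) :=
  MPSeries { mpscoef :> 'X_{1..n} -> R }.

HB.instance Definition _ n R := gen_eqMixin (mpseries n R).
HB.instance Definition _ n R := gen_choiceMixin (mpseries n R).

Lemma mpseriesP n R (f g : mpseries n R) : f =1 g -> f = g.
Proof. by case: f g => [f] [g] /= /funext ->. Qed.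

Section Ring.
Variables (n : nat) (R : comNzRingType).
Implicit Types (f g h : mpseries n R) (m : 'X_{1..n}).

Definition mps0 : mpseries n R := MPSeries (fun=> 0).
Definition mps1 : mpseries n R := MPSeries (fun m => (m == 0%MM)%:R).
Definition mpsopp f : mpseries n R := MPSeries (fun m => - f m).
Definition mpsadd f g : mpseries n R := MPSeries (fun m => f m + g m).
Definition mpsmul f g : mpseries n R := MPSeries (fun m =>
  \sum_(k : 'X_{1..n < (mdeg m).+1, (mdeg m).+1} | m == (k.1 + k.2)%MM)
    f k.1 * g k.2).

Definition mpstrunc d f : {mpoly R[n]} :=
  \sum_(m : 'X_{1..n < d}) f m *: 'X_[m].

Lemma mcoeff_trunc d f m : (mdeg m < d)%N -> (mpstrunc d f)@_m = f m.
Proof. exact: mcoeff_mpoly. Qed.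

Lemma mpsmul_coef f g m (p q : {mpoly R[n]}) :
  (forall k, (mdeg k <= mdeg m)%N -> p@_k = f k) ->
  (forall k, (mdeg k <= mdeg m)%N -> q@_k = g k) ->
  mpsmul f g m = (p * q)@_m.
Proof.
move=> pf qg; rewrite mcoeffM /=; apply: eq_bigr => -[[k1 h1] [k2 h2]] /= _.
by rewrite pf // qg.
Qed.

Lemma mpsmul_trunc d f g m : (mdeg m < d)%N ->
  mpsmul f g m = (mpstrunc d f * mpstrunc d g)@_m.
Proof.
by move=> md; apply: mpsmul_coef => k km; apply: mcoeff_trunc; exact: leq_ltn_trans md.
Qed.

Lemma mpsaddA : associative mpsadd.
Proof. by move=> f g h; apply: mpseriesP => m /=; rewrite addrA. Qed.
Lemma mpsaddC : commutative mpsadd.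
Proof. by move=> f g; apply: mpseriesP => m /=; rewrite addrC. Qed.
Lemma mpsadd0 : left_id mps0 mpsadd.
Proof. by move=> f; apply: mpseriesP => m /=; rewrite add0r. Qed.
Lemma mpsaddN : left_inverse mps0 mpsopp mpsadd.
Proof. by move=> f; apply: mpseriesP => m /=; rewrite addNr. Qed.

HB.instance Definition _ :=
  GRing.isZmodule.Build (mpseries n R) mpsaddA mpsaddC mpsadd0 mpsaddN.

Lemma mpsmulA : associative mpsmul.
Proof.
move=> f g h; apply: mpseriesP => m; pose d := (mdeg m).+1.
rewrite (@mpsmul_coef _ _ _ (mpstrunc d f) (mpstrunc d g * mpstrunc d h)).
- rewrite mulrA; apply/esym/mpsmul_coef => k km.
  + by rewrite (@mpsmul_trunc d).
  + exact: mcoeff_trunc.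
- by move=> k km; exact: mcoeff_trunc.
- by move=> k km; rewrite (@mpsmul_trunc d).
Qed.

Lemma mpsmulC : commutative mpsmul.
Proof.
by move=> f g; apply: mpseriesP => m; rewrite !(@mpsmul_trunc (mdeg m).+1) // mulrC.
Qed.

Lemma mpsmul1 : left_id mps1 mpsmul.
Proof.
move=> f; apply: mpseriesP => m.
rewrite (@mpsmul_coef _ _ _ 1 (mpstrunc (mdeg m).+1 f)).
- by rewrite mul1r mcoeff_trunc.
- by move=> k _; rewrite mcoeff1.
- by move=> k km; exact: mcoeff_trunc.
Qed.

Lemma mpsmulDl : left_distributive mpsmul mpsadd.
Proof.
move=> f g h; apply: mpseriesP => m /=; rewrite -big_split /=.
by apply: eq_bigr => k _; rewrite mulrDl.
Qed.

Lemma mps1_neq0 : mps1 != 0.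
Proof.
apply/eqP => /(congr1 (fun f => f 0%MM)) /= /eqP.
by rewrite eqxx oner_eq0.
Qed.

HB.instance Definition _ := GRing.Zmodule_isComNzRing.Build (mpseries n R)
  mpsmulA mpsmulC mpsmul1 mpsmulDl mps1_neq0.

Definition mps_unit : {pred mpseries n R} :=
  fun f => `[< exists g, g * f = 1 >].
Definition mps_inv f : mpseries n R := xget f [set g | g * f = 1].

Lemma mps_mulV : {in mps_unit, left_inverse 1 mps_inv *%R}.
Proof. by move=> f /asboolP ex; exact: (xgetPex f ex). Qed.

Lemma mps_unitP f g : g * f = 1 -> mps_unit f.
Proof. by move=> gf1; apply/asboolP; exists g. Qed.

Lemma mps_inv_out : {in [predC mps_unit], mps_inv =1 id}.
Proof.
move=> f; rewrite inE /= => /asboolP nex; rewrite /mps_inv.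
by case: xgetP => // g _ gf; case: nex; exists g.
Qed.

HB.instance Definition _ := GRing.ComNzRing_hasMulInverse.Build (mpseries n R)
  mps_mulV mps_unitP mps_inv_out.

Definition mps_of_mpoly (q : {mpoly R[n]}) : mpseries n R :=
  MPSeries (fun m => q@_m).

Definition mpsderiv (i : 'I_n) f : mpseries n R :=
  MPSeries (fun m => (m i).+1%:R * f (m + U_(i))%MM).

Lemma mps0E m : (0 : mpseries n R) m = 0. Proof. by []. Qed.
Lemma mps1E m : (1 : mpseries n R) m = (m == 0%MM)%:R. Proof. by []. Qed.
Lemma mpsaddE f g m : (f + g) m = f m + g m. Proof. by []. Qed.
Lemma mpssubE f g m : (f - g) m = f m - g m. Proof. by []. Qed.
Lemma mpsmulE f g m : (f * g) m =
  \sum_(k : 'X_{1..n < (mdeg m).+1, (mdeg m).+1} | m == (k.1 + k.2)%MM)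
    f k.1 * g k.2.
Proof. by []. Qed.

Lemma mps_of_mpoly_is_zmod_morphism : zmod_morphism mps_of_mpoly.
Proof. by move=> p q; apply: mpseriesP => m /=; rewrite mcoeffB. Qed.

Lemma mps_of_mpoly_is_monoid_morphism : monoid_morphism mps_of_mpoly.
Proof.
split=> [|p q]; apply: mpseriesP => m /=; first by rewrite mcoeff1.
by rewrite mcoeffM.
Qed.

HB.instance Definition _ := GRing.isZmodMorphism.Build _ _
  mps_of_mpoly mps_of_mpoly_is_zmod_morphism.
HB.instance Definition _ := GRing.isMonoidMorphism.Build _ _
  mps_of_mpoly mps_of_mpoly_is_monoid_morphism.

Lemma mpsderiv_of_mpoly i (q : {mpoly R[n]}) :
  mpsderiv i (mps_of_mpoly q) = mps_of_mpoly (mderiv i q).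
Proof.
by apply: mpseriesP => m /=; rewrite mcoeff_deriv mulr_natl.
Qed.

Lemma mpsderivD i : {morph mpsderiv i : f g / f + g}.
Proof. by move=> f g; apply: mpseriesP => m /=; rewrite mulrDr. Qed.

Lemma mpsderivM i f g :
  mpsderiv i (f * g) = mpsderiv i f * g + f * mpsderiv i g.
Proof.
apply: mpseriesP => m; pose d := (mdeg m).+2.
have dE h k : (mdeg k <= mdeg m)%N ->
    (mderiv i (mpstrunc d h))@_k = mpsderiv i h k.
  move=> km; rewrite mcoeff_deriv mcoeff_trunc.
    by rewrite /= mulr_natl.
  by rewrite mdegD mdeg1 addn1 ltnS.
have tE h k : (mdeg k <= mdeg m)%N -> (mpstrunc d h)@_k = h k.
  by move=> km; rewrite mcoeff_trunc // leqW.
rewrite mpsaddE [(f * _) m](mpsmul_coef (tE f) (dE g)).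
rewrite [(_ * g) m](mpsmul_coef (dE f) (tE g)) -mcoeffD -mderivM.
rewrite mcoeff_deriv -mulr_natl /=; congr (_ * _).
by apply: mpsmul_trunc; rewrite mdegD mdeg1 addn1.
Qed.

End Ring.

Section Domain.
Variables (n : nat) (R : idomainType).
Implicit Types (f g : mpseries n R) (m : 'X_{1..n}).

Lemma mps_neq0_least f : f != 0 ->
  exists2 m, f m != 0 & forall k, (k < m)%O -> f k = 0.
Proof.
move=> fN0; apply: contrapT => H; case/eqP: fN0; apply: mpseriesP => m.
change (f m = 0); elim/(@ltmwf n) : m => m IH.
by apply/eqP; apply: contrapT => /negP fm; apply: H; exists m.
Qed.

Lemma mps_idomain f g : f * g = 0 -> (f == 0) || (g == 0).
Proof.
move=> fg0; apply/negPn/negP; rewrite negb_or => /andP[].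
move=> /mps_neq0_least[a fa fmin] /mps_neq0_least[b gb gmin].
move: (congr1 (fun h : mpseries n R => h (a + b)%MM) fg0).
change ((f * g) (a + b)%MM = 0 -> False); rewrite mpsmulE.
have ha : (mdeg a < (mdeg (a + b)).+1)%N by rewrite mdegD ltnS leq_addr.
have hb : (mdeg b < (mdeg (a + b)).+1)%N by rewrite mdegD ltnS leq_addl.
rewrite (bigD1 (BMultinom ha, BMultinom hb)) //= big1 ?addr0.
  by move/eqP; rewrite mulf_eq0 (negPf fa) (negPf gb).
move=> [[k1 h1] [k2 h2]] /= /andP[/eqP eab].
move=> kN.
have [/fmin->|k1a] := ltP k1 a; first by rewrite mul0r.
have [/gmin->|k2b] := ltP k2 b; first by rewrite mulr0.
exfalso; have : ((a + b)%MM < (k1 + k2)%MM)%O.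
  have [e1|ne1] := eqVneq k1 a; last first.
    by apply: ltmc_le_add => //; rewrite lt_neqAle eq_sym ne1.
  rewrite e1 ltmc_add2r lt_neqAle k2b andbT; apply: contraNneq kN => e2.
  by apply/eqP; congr (_, _); apply: val_inj.
by rewrite eab ltxx.
Qed.

HB.instance Definition _ :=
  GRing.ComUnitRing_isIntegral.Build (mpseries n R) mps_idomain.

(* The derivation of the fraction field extending d/dX_i, by the quotient rule
   on the canonical representative; fderiv_div shows that any other
   representative gives the same value. *)
Definition fderiv (i : 'I_n) (x : {fraction (mpseries n R)}) :
    {fraction (mpseries n R)} :=
  let f := (frac (repr x)).1 in let g := (frac (repr x)).2 in
  tofrac (mpsderiv i f * g - f * mpsderiv i g) / tofrac (g ^+ 2).

Lemma tofrac_numden (x : {fraction (mpseries n R)}) :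
  x = tofrac (frac (repr x)).1 / tofrac (frac (repr x)).2.
Proof.
set r := repr x; have rN0 : (frac r).2 != 0 by exact: denom_ratioP.
apply: (canRL (mulfK _)); first by rewrite tofrac_eq0.
rewrite -[x in LHS]reprK -/r; unlock tofrac; rewrite -[LHS]FracField.pi_mul.
apply/eqmodP; rewrite /= FracField.equivfE /FracField.mulf.
by rewrite !numden_Ratio ?mulf_neq0 ?oner_neq0 // !mulr1 mulrC.
Qed.

Lemma fderiv_div i f g : g != 0 ->
  fderiv i (tofrac f / tofrac g) =
    tofrac (mpsderiv i f * g - f * mpsderiv i g) / tofrac (g ^+ 2).
Proof.
move=> gN0; rewrite /fderiv; set x := (X in repr X).
have := tofrac_numden x.
have : (frac (repr x)).2 != 0 by exact: denom_ratioP.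
move: (frac (repr x)) => [u v] /= vN0; rewrite /x => /eqP.
rewrite eqr_div ?tofrac_eq0 // -!tofracM tofrac_eq => /eqP fv.
apply/eqP; rewrite eqr_div ?tofrac_eq0 ?expf_neq0 // -!tofracM tofrac_eq.
have dfv := congr1 (mpsderiv i) fv; rewrite !mpsderivM in dfv.
apply/eqP.
set f' := mpsderiv i f in dfv *; set g' := mpsderiv i g in dfv *.
set u' := mpsderiv i u in dfv *; set v' := mpsderiv i v in dfv *.
apply/eqP; rewrite -subr_eq0; apply/eqP.
rewrite [LHS](_ : _ = v * g * (u' * g + u * g' - (f' * v + f * v'))
                      + (f * v - u * g) * (g' * v + v' * g)); last by ring.
by rewrite dfv fv !subrr mulr0 mul0r addr0.
Qed.

End Domain.

(* R[[X_1^p, ..., X_n^p]] inside R[[X_1, ..., X_n]] *)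
Definition mpsXp (p n : nat) (R : idomainType) : set (mpseries n R) :=
  [set f : mpseries n R | forall m, f m != 0 -> forall i, (p %| m i)%N].

(* The fraction field of R[[X_1^p, ..., X_n^p]] inside that of
   R[[X_1, ..., X_n]] *)
Definition fracXp (p n : nat) (R : idomainType) :
    set {fraction (mpseries n R)} :=
  [set x | exists f g : mpseries n R,
     [/\ mpsXp p f, mpsXp p g, g != 0 & x = tofrac f / tofrac g]].

Section Xp.
Variables (p n : nat) (R : idomainType).
Implicit Types f g : mpseries n R.

Lemma mpsXp1 : mpsXp p (1 : mpseries n R).
Proof.
by move=> m; rewrite mps1E; case: (eqVneq m 0%MM) => [-> _ i|_]; rewrite ?eqxx // mnm0E.
Qed.

Lemma mpsXpB f g : mpsXp p f -> mpsXp p g -> mpsXp p (f - g).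
Proof.
move=> hf hg m; rewrite mpssubE => fgm i.
have [fm0|/hf //] := eqVneq (f m) 0; apply: hg.
by apply: contraNneq fgm => ->; rewrite fm0 subr0.
Qed.

Lemma mpsXpM f g : mpsXp p f -> mpsXp p g -> mpsXp p (f * g).
Proof.
move=> hf hg m fgm i; apply: contraNT fgm => pm; rewrite mpsmulE.
apply/eqP; rewrite big1 // => -[[k1 ?] [k2 ?]] /= /eqP mE.
have [->|f0] := eqVneq (f k1) 0; first by rewrite mul0r.
have [->|g0] := eqVneq (g k2) 0; first by rewrite mulr0.
exfalso; move: pm; rewrite mE mnmDE dvdn_add //; [exact: hf|exact: hg].
Qed.

Lemma fracXp_divring_closed : divring_closed (mem (@fracXp p n R)).
Proof.
split.
- rewrite inE; exists 1, 1; split; [exact: mpsXp1|exact: mpsXp1|exact: oner_neq0|].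
  by rewrite tofrac1 divr1.
- move=> x y; rewrite !inE => -[f [g [hf hg g0 ->]]] [f' [g' [hf' hg' g0' ->]]].
  exists (f * g' - f' * g), (g * g').
  split; rewrite ?mulf_neq0 //; first by apply: mpsXpB; exact: mpsXpM.
    exact: mpsXpM.
  by rewrite tofracB !tofracM -mulNr addf_div ?tofrac_eq0 // mulNr.
- move=> x y; rewrite !inE => -[f [g [hf hg g0 ->]]] [f' [g' [hf' hg' g0' ->]]].
  have [->|f0'] := eqVneq f' 0.
    exists 0, 1; rewrite tofrac0 mul0r invr0 mulr0 mul0r.
    split=> //; [|exact: mpsXp1|exact: oner_neq0].
    by move=> m; rewrite mps0E eqxx.
  exists (f * g'), (g * f').
  split; rewrite ?mulf_neq0 //; [exact: mpsXpM|exact: mpsXpM|].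
  by rewrite invf_div mulf_div !tofracM.
Qed.

End Xp.

Section Basis.
Variables (F : fieldType) (K : set F).

Definition lin_indep (B : set F) : Prop :=
  forall (s : seq F) (c : F -> F), uniq s ->
    (forall b, b \in s -> B b) -> (forall b, b \in s -> K (c b)) ->
    \sum_(b <- s) c b * b = 0 -> forall b, b \in s -> c b = 0.

Definition lin_span (B : set F) : set F :=
  [set x | exists (s : seq F) (c : F -> F),
     [/\ uniq s, forall b, b \in s -> B b, forall b, b \in s -> K (c b)
       & x = \sum_(b <- s) c b * b]].

(* K is meant to be a subfield of F; S = lin_span B includes that S is a
   K-subspace and that B lies in S. *)
Definition is_basis (B S : set F) : Prop := lin_indep B /\ S = lin_span B.

End Basis.

Section GKZ.
Variables (p N n : nat) (a : 'I_N -> 'rV[int]_n).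
Implicit Types (beta gamma : 'rV[int]_n) (u : 'X_{1..N}) (l : 'I_N -> int).

Local Notation field := {fraction (mpseries N 'F_p)}.

Definition lattice : set ('I_N -> int) := [set l | \sum_i a i *~ l i = 0].

Definition NA : set 'rV[int]_n := [set \sum_i a i *+ u i | u in @setT 'X_{1..N}].

Definition Uplus gamma : set 'X_{1..N} := [set u | \sum_i a i *+ u i = gamma].

Definition Uplus_pred gamma : set 'X_{1..N} :=
  [set u | Uplus gamma u /\ forall i, (u i <= p.-1)%N].

(* the least \sum_i u_i = mdeg u over Uplus gamma; the default 0 is taken only
   for gamma outside NA *)
Definition weight gamma : nat :=
  xget 0%N [set d | (exists2 u, Uplus gamma u & mdeg u = d) /\
                    forall u, Uplus gamma u -> (d <= mdeg u)%N].

Definition Umin gamma : set 'X_{1..N} :=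
  [set u | Uplus gamma u /\ mdeg u = weight gamma].

Definition good gamma : Prop := Umin gamma `<=` Uplus_pred gamma.

Definition Fpoly gamma : {mpoly 'F_p[N]} :=
  \sum_(u : 'X_{1..N < (weight gamma).+1} | `[< Umin gamma u >])
    (\prod_(i < N) ((u i)`!)%:R)^-1 *: 'X_[u].

Definition sigmaA beta : set 'rV[int]_n :=
  [set gamma | [/\ exists delta : 'rV[int]_n, gamma = beta + delta *+ p,
                   NA gamma & good gamma]].

Definition frac_of_mpoly (q : {mpoly 'F_p[N]}) : field :=
  tofrac (mps_of_mpoly q).

Definition euler_op beta (i : 'I_n) (G : field) : field :=
  \sum_(j < N) (a j 0 i)%:~R * (frac_of_mpoly 'X_j * fderiv j G)
    - (beta 0 i)%:~R * G.

Definition deriv_pos l : field -> field :=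
  \big[(fun P Q => P \o Q)/id]_(i < N | 0 < l i) iter `|l i|%N (fderiv i).

Definition deriv_neg l : field -> field :=
  \big[(fun P Q => P \o Q)/id]_(i < N | l i < 0) iter `|l i|%N (fderiv i).

Definition box_bar l (G : field) : field :=
  if 0 < \sum_(i < N) l i then deriv_pos l G
  else if \sum_(i < N) l i < 0 then deriv_neg l G
  else deriv_pos l G - deriv_neg l G.

Definition solA beta : set field :=
  [set G | (forall i, euler_op beta i G = 0) /\
           (forall l, lattice l -> box_bar l G = 0)].

End GKZ.

Arguments solA p [N n] a beta _.

(* Main.v *)
(** Any [G] in F_p((X)) can be written [f / g] with [g] in F_p[[X^p]], since
    [1 / g = g ^ (p - 1) / g ^ p], and derivations treat such a [g] as a
    constant; so only power series matter, on which all the operators act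
    coefficient by coefficient.  Write an exponent as [u + p q] with [u] in the
    box [0, p - 1]^N and put [c u q = u! f_(u + p q)].  The Euler equations
    force [gamma = sum_i u_i a_i] to be congruent to [beta] wherever
    [c u q != 0].  For [v] in [Uplus gamma], the box operator of [u - v] at the
    exponent [min(u, v) + p q] says [c u q = 0] if [|v| < |u|] and
    [c u q = c v q] if [|v| = |u|], where [v! = 0] in F_p if [v] leaves the box.
    Hence [f] lives on the [Umin gamma] with [gamma] good, and [c] is constant
    in [u] there: [f] is a combination of the [F_gamma], whose supports are
    disjoint. *)
Require Import Defs.
From HB Require Import structures.
From mathcomp Require Import all_boot all_order all_algebra.
From mathcomp Require Import fraction boolp classical_sets.
From mathcomp Require Import mpoly.

Set Implicit Arguments.
Unset Strict Implicit.
Unset Printing Implicit Defensive.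

Import Order.TTheory GRing.Theory Num.Theory.

Local Open Scope classical_set_scope.
Local Open Scope ring_scope.

(** * Factorials and derivative factors of exponent vectors *)

Section Multinomials.
Variable N : nat.
Implicit Types (m k w q u v : 'X_{1..N}).

Definition mfact m : nat := \prod_i (m i)`!.

(** The factor by which the derivative of order [k] takes [X^(m + k)] to a multiple of [X^m], namely
    [(m + k)! / m!]. Falling factorials keep it meaningful modulo [p] even where [m!] vanishes in
    F_p. *)
Definition mrise m k : nat := \prod_i ((m i + k i) ^_ (k i))%N.

Lemma mrise_fact m k : (mrise m k * mfact m)%N = mfact (m + k)%MM.
Proof.
rewrite /mrise /mfact -big_split; apply: eq_bigr => i _ /=.
by rewrite mnmDE -(@ffact_fact (m i + k i) (k i)) ?leq_addl // addnK.
Qed.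

Lemma mfact_gt0 m : (0 < mfact m)%N.
Proof. by apply: prodn_gt0 => i; exact: fact_gt0. Qed.

Lemma mriseD m k k' : mrise m (k + k')%MM = (mrise m k * mrise (m + k)%MM k')%N.
Proof.
apply/eqP; rewrite -(eqn_pmul2r (mfact_gt0 m)) mrise_fact mulnAC mrise_fact.
by rewrite mulnC mrise_fact addmA.
Qed.

Lemma mrise0 m : mrise m 0%MM = 1%N.
Proof.
by apply/eqP; rewrite -(eqn_pmul2r (mfact_gt0 m)) mrise_fact addm0 mul1n.
Qed.

Lemma mriseU m i : mrise m U_(i)%MM = (m i).+1.
Proof.
rewrite /mrise (bigD1 i) //= mnm1E eqxx addn1 ffactn1 big1 ?muln1 // => j ji.
by rewrite mnm1E eq_sym (negPf ji) ffactn0.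
Qed.

Definition mbox p m : bool := [forall i, (m i < p)%N].

Lemma mboxP p m : reflect (forall i, (m i < p)%N) (mbox p m).
Proof. exact: forallP. Qed.

Lemma mnm_edivn p m : (0 < p)%N ->
  exists w q, mbox p w /\ m = (w + q *+ p)%MM.
Proof.
move=> p_gt0; exists [multinom (m i %% p)%N | i < N], [multinom (m i %/ p)%N | i < N].
split; first by apply/mboxP => i; rewrite mnmE ltn_mod.
by apply/mnmP => i; rewrite mnmDE mulmnE !mnmE addnC -divn_eq.
Qed.

End Multinomials.

(** * Factorials and exponents modulo [p] *)

Section PrimeField.
Variables (p N : nat).
Hypothesis p_prime : prime p.
Implicit Types (m k w q u v : 'X_{1..N}).

Lemma Fp_natr_eq0 d : ((d%:R : 'F_p) == 0) = (p %| d)%N.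
Proof. by rewrite (dvdn_pcharf (pchar_Fp p_prime)). Qed.

Lemma Fp_intr_eq0 (z : int) : ((z%:~R : 'F_p) == 0) = (p %| z)%Z.
Proof. by rewrite (dvdz_pcharf (pchar_Fp p_prime)). Qed.

Lemma prime_dvdn_fact d : (p %| d`!)%N = (p <= d)%N.
Proof.
elim: d => [|d IH]; first by rewrite dvdn1 leqNgt prime_gt0 // gtn_eqF ?prime_gt1.
rewrite factS Euclid_dvdM // IH; apply/orP/idP => [[/dvdn_leq->//|/leqW//]|].
by rewrite leq_eqVlt => /orP[/eqP->|]; [left|right].
Qed.

Lemma mfact_Fp_eq0 m : (((mfact m)%:R : 'F_p) == 0) = ~~ mbox p m.
Proof.
rewrite /mfact natr_prod; apply/idP/idP.
  apply: contraTN => /mboxP mp; apply/prodf_neq0 => i _.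
  by rewrite Fp_natr_eq0 prime_dvdn_fact -ltnNge.
rewrite negb_forall => /existsP[i]; rewrite -leqNgt => pi.
by rewrite (bigD1 i) //= mulf_eq0 Fp_natr_eq0 prime_dvdn_fact pi.
Qed.

(** Each factor of the falling factorials changes by a multiple of [p]. *)
Lemma mrise_Fp w q k :
  (mrise (w + q *+ p)%MM k)%:R = (mrise w k)%:R :> 'F_p.
Proof.
rewrite /mrise !natr_prod; apply: eq_bigr => i _; rewrite mnmDE mulmnE.
rewrite !ffact_prod !natr_prod; apply: eq_bigr => -[j jk] _ /=.
rewrite addnAC -addnBAC; last exact: leq_trans (ltnW jk) (leq_addl _ _).
by rewrite natrD natrM (pcharf0 (pchar_Fp p_prime)) mulr0 addr0.
Qed.

Lemma mrise_mfactV w k : mbox p w ->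
  (mrise w k)%:R = (mfact (w + k)%MM)%:R / (mfact w)%:R :> 'F_p.
Proof.
move=> wp; apply: canRL (mulfK _) _; first by rewrite mfact_Fp_eq0 negbK.
by rewrite -natrM mrise_fact.
Qed.

Lemma mbox_edivn_inj w w' q q' : mbox p w -> mbox p w' ->
  (w + q *+ p = w' + q' *+ p)%MM -> w = w' /\ q = q'.
Proof.
move=> /mboxP wp /mboxP wp' /mnmP e.
have p0 := prime_gt0 p_prime.
split; apply/mnmP => i; have := e i; rewrite !mnmDE !mulmnE ![(_ + _ * p)%N]addnC => ei.
  by have := congr1 (modn^~ p) ei; rewrite !modnMDl !modn_small.
by have := congr1 (divn^~ p) ei; rewrite !divnMDl // !divn_small // !addn0.
Qed.

End PrimeField.

(** * Derivatives of power series *)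

Section SeriesDerivatives.
Variables (n : nat) (R : comNzRingType).
Implicit Types (f g : mpseries n R) (m k : 'X_{1..n}).

(** The iterated partial derivative of order [k i] in each variable, given at once by its
    coefficients, so that composing only adds orders. *)
Definition mpsderivm k f : mpseries n R :=
  MPSeries (fun m => (mrise m k)%:R * f (m + k)%MM).

Lemma mpsderivm0 f : mpsderivm 0%MM f = f.
Proof. by apply: mpseriesP => m /=; rewrite mrise0 mul1r addm0. Qed.

Lemma mpsderivmD k k' f : mpsderivm k (mpsderivm k' f) = mpsderivm (k + k')%MM f.
Proof. by apply: mpseriesP => m /=; rewrite mriseD natrM mulrA addmA. Qed.

Lemma mpsderivmU i f : mpsderivm U_(i)%MM f = mpsderiv i f.
Proof. by apply: mpseriesP => m /=; rewrite mriseU. Qed.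

Lemma mpsX_derivE i f m :
  (mps_of_mpoly 'X_i * mpsderiv i f) m = (m i)%:R * f m.
Proof.
have [mi0|mi] := posnP (m i).
  (* [U_(i)] is not a summand of [m], so every term of the Cauchy product vanishes. *)
  rewrite mi0 mul0r mpsmulE big1 // => -[[k1 h1] [k2 h2]] /= /eqP mE.
  rewrite mcoeffX; case: eqVneq => [ik|]; last by rewrite mul0r.
  by move: mi0; rewrite mE -ik mnmDE mnm1E eqxx.
have -> : m = (U_(i) + (m - U_(i)))%MM.
  apply/mnmP => j; rewrite mnmDE mnmBE mnm1E.
  by case: eqP => [<-|_]; rewrite ?subn0 ?add0n // subnKC.
(* Truncating above the degree of [m] keeps this coefficient, which is then computed with
   polynomials. *)
set k := (m - U_(i))%MM; pose d := (mdeg (U_(i) + k)%MM).+1.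
rewrite mulrC.
have -> := @mpsmul_coef _ _ (mpsderiv i f) (mps_of_mpoly 'X_i) (U_(i) + k)%MM
             (mpstrunc d (mpsderiv i f)) 'X_i.
- rewrite mcoeffMX mcoeff_trunc; last by rewrite /d mdegD ltnS leq_addl.
  by rewrite /= mnmDE mnm1E eqxx addmC.
- by move=> k' km; rewrite mcoeff_trunc.
- by [].
Qed.

Lemma mpsderivX i g d : mpsderiv i (g ^+ d) = g ^+ d.-1 * mpsderiv i g *+ d.
Proof.
elim: d => [|d IH].
  rewrite expr0 mulr0n; apply: mpseriesP => m /=.
  by case: eqP => [/mnmP/(_ i)|]; rewrite ?mulr0 // mnmDE mnm1E mnm0E eqxx addn1.
rewrite exprS mpsderivM IH mulrS /= [X in X + _]mulrC; congr (_ + _).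
by case: d {IH} => [|d]; rewrite ?mulr0n ?mulr0 // mulrnAr mulrA -exprS.
Qed.

End SeriesDerivatives.

(** * Constants of the derivations, and fractions over them *)

Section CoefficientwiseOperators.
Variables (p n : nat).
Hypothesis p_prime : prime p.
Local Notation series := (mpseries n 'F_p).
Implicit Types (f g h : series).

(** The factor [m i + 1] that a derivation puts on a coefficient vanishes in F_p exactly when [p]
    divides it, so no other coefficient can be killed. *)
Lemma mpsXp_deriv g : mpsXp p g <-> forall i, mpsderiv i g = 0.
Proof.
split=> [gp i|dg0 m gm i].
  apply: mpseriesP => m /=; apply/eqP; rewrite mulf_eq0 orbC -implyNb.
  apply/implyP => /gp/(_ i); rewrite mnmDE mnm1E eqxx addn1.
  by rewrite Fp_natr_eq0.
have [->//|mi] := posnP (m i).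
have mE : m = (m - U_(i) + U_(i))%MM.
  apply/mnmP => j; rewrite mnmDE mnmBE mnm1E.
  by case: eqP => [<-|_]; rewrite ?subn0 ?addn0 // subnK.
have /eqP := congr1 (fun f : series => f (m - U_(i))%MM) (dg0 i).
rewrite /= -mE mulf_eq0 (negPf gm) orbF mnmBE mnm1E eqxx subn1 prednK //.
by rewrite Fp_natr_eq0.
Qed.

Lemma mps_natr_p : p%:R = 0 :> series.
Proof.
have -> : p%:R = mps_of_mpoly (p%:R : {mpoly 'F_p[n]}) by rewrite rmorph_nat.
by rewrite -mpolyC_nat (pcharf0 (pchar_Fp p_prime)) mpolyC0 raddf0.
Qed.

(** The derivative of [g ^ p] carries the factor [p], which is 0. *)
Lemma mpsXp_exp g : mpsXp p (g ^+ p).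
Proof.
by apply/mpsXp_deriv => i; rewrite mpsderivX -mulr_natl mps_natr_p mul0r.
Qed.

Lemma frac_denXp (x : {fraction series}) :
  exists f g, [/\ mpsXp p g, g != 0 & x = tofrac f / tofrac g].
Proof.
rewrite [x]tofrac_numden; set g := (X in _ / tofrac X).
have g0 : g != 0 by exact: denom_ratioP.
set f := (X in tofrac X / _); clearbody f g.
exists (f * g ^+ p.-1), (g ^+ p); split; rewrite ?expf_neq0 //.
  exact: mpsXp_exp.
apply/eqP; rewrite eqr_div ?tofrac_eq0 ?expf_neq0 // -!tofracM.
by rewrite -mulrA -exprSr prednK ?prime_gt0.
Qed.

Lemma fderiv_denXp i f g : mpsXp p g -> g != 0 ->
  fderiv i (tofrac f / tofrac g) = tofrac (mpsderiv i f) / tofrac g.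
Proof.
move=> /mpsXp_deriv gp g0; rewrite fderiv_div // gp mulr0 subr0 expr2 !tofracM.
by rewrite -mulf_div divff ?mulr1 // tofrac_eq0.
Qed.

Lemma fderivs_denXp (P : pred 'I_n) (e : 'I_n -> nat) f g : mpsXp p g -> g != 0 ->
  (\big[(fun A B => A \o B)/id]_(i < n | P i) iter (e i) (fderiv i))
    (tofrac f / tofrac g) =
  tofrac (mpsderivm (\sum_(i < n | P i) U_(i) *+ e i)%MM f) / tofrac g.
Proof.
move=> gp g0.
(* The numerator is quantified in the invariant because each operator of the composite changes
   it. *)
pose K (A : {fraction series} -> {fraction series}) k := forall f,
  A (tofrac f / tofrac g) = tofrac (mpsderivm k f) / tofrac g.
apply: (big_rec2 K) f => [f|i A k Pi IH f]; first by rewrite mpsderivm0.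
rewrite /= IH -mpsderivmD; move: (mpsderivm k f) => {IH}f.
elim: (e i) => [|d IH]; first by rewrite mulm0n mpsderivm0.
by rewrite iterS IH fderiv_denXp // mulmS -mpsderivmD mpsderivmU.
Qed.

(** Turns a finite linear relation over the constant field into one between power series. *)
Lemma fracXp_common_den (T : eqType) (s : seq T) (c : T -> {fraction series}) :
  (forall b, b \in s -> @fracXp p n 'F_p (c b)) ->
  exists (h : T -> series) g, [/\ mpsXp p g, g != 0,
    forall b, b \in s -> mpsXp p (h b)
    & forall b, b \in s -> c b = tofrac (h b) / tofrac g].
Proof.
elim: s => [|b s IH] cK.
  by exists (fun=> 0), 1; split=> //; [exact: mpsXp1|exact: oner_neq0].
have [x xs|h [g [gp g0 hp hE]]] := IH; first by apply: cK; rewrite inE xs orbT.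
have [|f' [g' [fp' gp' g0' cE]]] := cK b; first by rewrite inE eqxx.
exists (fun x => if x == b then f' * g else h x * g'), (g * g').
split; rewrite ?mulf_neq0 //.
- exact: mpsXpM.
- move=> x; rewrite inE; case: eqP => [_ _|_ /= xs]; first exact: mpsXpM.
  by apply: mpsXpM => //; exact: hp.
- move=> x; rewrite inE; case: eqP => [-> _|_ /= xs].
    by rewrite cE [g * _]mulrC !tofracM -mulf_div divff ?mulr1 ?tofrac_eq0.
  by rewrite hE // !tofracM -mulf_div divff ?mulr1 ?tofrac_eq0.
Qed.

(** Division with remainder by [p] is unique in each exponent, so a single term of the Cauchy
    product survives. *)
Lemma mpsXp_mul_box h f w q : mpsXp p h -> (forall m, f m != 0 -> mbox p m) ->
  mbox p w -> (h * f) (w + q *+ p)%MM = h (q *+ p)%MM * f w.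
Proof.
move=> hp fp wp; rewrite mpsmulE; set m := (w + q *+ p)%MM.
have hq : (mdeg (q *+ p)%MM < (mdeg m).+1)%N by rewrite ltnS mdegD leq_addl.
have hw : (mdeg w < (mdeg m).+1)%N by rewrite ltnS mdegD leq_addr.
rewrite (bigD1 (BMultinom hq, BMultinom hw)) /=; last by rewrite addmC.
rewrite big1 ?addr0 // => -[[k1 h1] [k2 h2]] /= /andP[/eqP mE].
apply: contraNeq; rewrite mulf_eq0 negb_or => /andP[/hp hk1 /fp k2p].
have k1E : k1 = ([multinom (k1 i %/ p)%N | i < n] *+ p)%MM.
  by apply/mnmP => i; rewrite mulmnE mnmE divnK.
move: mE; rewrite addmC {1}k1E => /(mbox_edivn_inj p_prime wp k2p)[wE qE].
by apply/eqP; congr (_, _); apply: val_inj => //=; rewrite k1E qE.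
Qed.

End CoefficientwiseOperators.

(** * Linear combinations of series and of images *)

Lemma mpssumE n (R : comNzRingType) I (r : seq I) (P : pred I)
    (F : I -> mpseries n R) m :
  (\sum_(i <- r | P i) F i) m = \sum_(i <- r | P i) F i m.
Proof. exact: (big_morph (fun f : mpseries n R => f m)). Qed.

Lemma mps_intrE n (R : comNzRingType) (z : int) (f : mpseries n R) m :
  (z%:~R * f) m = z%:~R * f m.
Proof.
have natE (d : nat) : (f *+ d) m = f m *+ d.
  by elim: d => // d IH; rewrite !mulrS mpsaddE IH.
rewrite !mulrzl; case: z => d; first exact: natE.
by rewrite -[f *~ _]/(- (f *+ d.+1)) -[_ *~ _]/(- (f m *+ d.+1)) -natE.
Qed.

(** [lin_span] indexes combinations by the vectors themselves; injectivity of [phi] on [S] keeps the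
    list of images free of duplicates and lets the coefficients be carried along an inverse. *)
Lemma lin_span_image (F : fieldType) (K : set F) (T : eqType) (S : set T)
    (phi : T -> F) (s : seq T) (c : T -> F) :
  (forall x y, S x -> S y -> phi x = phi y -> x = y) -> uniq s ->
  (forall x, x \in s -> S x) -> (forall x, x \in s -> K (c x)) ->
  lin_span K [set phi x | x in S] (\sum_(x <- s) c x * phi x).
Proof.
(* A nonempty list provides the default element for [nth]. *)
move=> phi_inj; case: s => [|x0 s'] us sS sK.
  by exists [::], (fun=> 0); split=> //; rewrite !big_nil.
move: us sS sK; set s := x0 :: s' => us sS sK.
have phi_in : {in s &, injective phi}.
  by move=> x y xs ys; apply: phi_inj; exact: sS.
pose inv b := nth x0 s (index b (map phi s)).
have invK x : x \in s -> inv (phi x) = x.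
  move=> xs; have ps : phi x \in map phi s by exact: map_f.
  have ip : (index (phi x) (map phi s) < size s)%N.
    by rewrite -(size_map phi) index_mem.
  by apply: phi_in; rewrite ?mem_nth // -(nth_map _ (phi x0)) ?nth_index.
exists (map phi s), (c \o inv); split.
- by rewrite map_inj_in_uniq.
- by move=> _ /mapP[x xs ->]; exists x => //; exact: sS.
- by move=> _ /mapP[x xs ->]; rewrite /= invK //; exact: sK.
- by rewrite big_map; apply: eq_big_seq => x xs; rewrite /= invK.
Qed.

(** * Lattice relations and minimal exponents *)

Section Lattice.
Variables (N n : nat) (a : 'I_N -> 'rV[int]_n).
Implicit Types (gamma : 'rV[int]_n) (u v w k q : 'X_{1..N}) (l : 'I_N -> int).

Definition mcomb u : 'rV[int]_n := \sum_i a i *+ u i.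

Lemma mcombD u v : mcomb (u + v)%MM = mcomb u + mcomb v.
Proof. by rewrite -big_split; apply: eq_bigr => i _; rewrite mnmDE mulrnDr. Qed.

Lemma mcombMn u d : mcomb (u *+ d)%MM = mcomb u *+ d.
Proof. by rewrite -sumrMnl; apply: eq_bigr => i _; rewrite mulmnE mulrnA. Qed.

(** Positive and negative parts of [l], in the form of the orders that [fderivs_denXp] yields for
    [deriv_pos] and [deriv_neg]. *)
Definition lpos l : 'X_{1..N} := (\sum_(i < N | (0 < l i)%R) U_(i) *+ `|l i|%N)%MM.
Definition lneg l : 'X_{1..N} := (\sum_(i < N | (l i < 0)%R) U_(i) *+ `|l i|%N)%MM.

Lemma mnm_sum_predE (P : pred 'I_N) (e : 'I_N -> nat) j :
  (\sum_(i < N | P i) U_(i) *+ e i)%MM j = if P j then e j else 0%N.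
Proof.
rewrite mnm_sumE; under eq_bigr do rewrite mulmnE mnm1E.
case: ifPn => Pj; last first.
  by rewrite big1 // => i Pi; case: eqP Pj => // <-; rewrite Pi.
rewrite (bigD1 j) //= eqxx mul1n big1 ?addn0 // => i /andP[_ ij].
by rewrite (negPf ij).
Qed.

Lemma lposBneg l j : (lpos l j)%:Z - (lneg l j)%:Z = l j.
Proof.
rewrite !mnm_sum_predE; case: (ltgtP (l j) 0) => [lj|lj|->//].
  by rewrite sub0r -abszN gez0_abs ?opprK // oppr_ge0 ltW.
by rewrite subr0 gez0_abs // ltW.
Qed.

Lemma mcomb_lposneg l w : lattice a l ->
  mcomb (w + lpos l)%MM = mcomb (w + lneg l)%MM.
Proof.
move=> la; rewrite !mcombD; congr (_ + _); apply/eqP; rewrite -subr_eq0 -sumrB.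
apply/eqP; rewrite -[RHS]la; apply: eq_bigr => i _.
by rewrite -lposBneg mulrzBr.
Qed.

Lemma mdeg_lposneg l w :
  (mdeg (w + lpos l)%MM)%:Z - (mdeg (w + lneg l)%MM)%:Z = \sum_i l i.
Proof.
rewrite !mdegD !PoszD addrAC opprD addrA subrr sub0r addrC !mdegE.
rewrite !(big_morph Posz PoszD (erefl _)) -sumrB.
by apply: eq_bigr => i _; rewrite lposBneg.
Qed.

Definition ldiff u v : 'I_N -> int := fun i => (u i)%:Z - (v i)%:Z.

Lemma lattice_ldiff u v : mcomb u = mcomb v -> lattice a (ldiff u v).
Proof.
move=> uv; rewrite /lattice /=; under eq_bigr do rewrite mulrzBr.
by rewrite sumrB -[X in X - _]/(mcomb u) uv subrr.
Qed.

Lemma lpos_ldiff u v : lpos (ldiff u v) = (u - v)%MM.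
Proof.
apply/mnmP => i; rewrite mnm_sum_predE mnmBE /ldiff subr_gt0 ltz_nat.
by case: ltnP => [vu|uv]; [rewrite distnEl // ltnW | apply/esym/eqP].
Qed.

Lemma lneg_ldiff u v : lneg (ldiff u v) = (v - u)%MM.
Proof.
apply/mnmP => i; rewrite mnm_sum_predE mnmBE /ldiff subr_lt0 ltz_nat.
by case: ltnP => [uv|vu]; [rewrite distnEr // ltnW | apply/esym/eqP].
Qed.

Lemma sum_ldiff u v : \sum_i ldiff u v i = (mdeg u)%:Z - (mdeg v)%:Z.
Proof. by rewrite !mdegE !(big_morph Posz PoszD (erefl _)) sumrB. Qed.

(** The exponent at which the box operator of [u - v] is evaluated: its two monomial derivatives
    then read the coefficients at [u] and at [v]. *)
Definition mmeet u v : 'X_{1..N} := [multinom minn (u i) (v i) | i < N].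

Lemma mmeetl u v : (mmeet u v + (u - v))%MM = u.
Proof. by apply/mnmP => i; rewrite mnmDE mnmBE mnmE minnE subnK ?leq_subr. Qed.

Lemma mmeetr u v : (mmeet u v + (v - u))%MM = v.
Proof.
by rewrite -[RHS](mmeetl v u); congr (_ + _)%MM; apply/mnmP => i; rewrite !mnmE minnC.
Qed.

(** A nonempty set of degrees has a least element, so [xget] in [weight] returns a true minimum and
    not its default. *)
Lemma Uplus_weight gamma u : Uplus a gamma u ->
  (exists v, Umin a gamma v) /\ (weight a gamma <= mdeg u)%N.
Proof.
move=> gu; pose P d := `[< exists2 v, Uplus a gamma v & mdeg v = d >].
have exP : exists d, P d by exists (mdeg u); apply/asboolP; exists u.
have [] : (exists2 v, Uplus a gamma v & mdeg v = weight a gamma) /\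
    forall v, Uplus a gamma v -> (weight a gamma <= mdeg v)%N.
  apply: (@xgetPex _ 0%N [set d | (exists2 u, Uplus a gamma u & mdeg u = d) /\
                    forall u, Uplus a gamma u -> (d <= mdeg u)%N]).
  case: (ex_minnP exP) => d /asboolP Pd dmin; exists d; split=> // v gv.
  by apply: dmin; apply/asboolP; exists v.
by move=> [v gv vE] wmin; split; [exists v | exact: wmin].
Qed.

End Lattice.

(** * The differential operators on numerators *)

Section Solutions.
Variables (p N n : nat) (a : 'I_N -> 'rV[int]_n) (beta : 'rV[int]_n).
Hypothesis p_prime : prime p.
Local Notation series := (mpseries N 'F_p).
Implicit Types (f g h : series) (gamma : 'rV[int]_n) (u v w k q : 'X_{1..N}).

Definition box_series (l : 'I_N -> int) f : series :=
  if 0 < \sum_(i < N) l i then mpsderivm (lpos l) f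
  else if \sum_(i < N) l i < 0 then mpsderivm (lneg l) f
  else mpsderivm (lpos l) f - mpsderivm (lneg l) f.

Definition euler_series i f : series :=
  MPSeries (fun m => ((mcomb a m - beta) 0 i)%:~R * f m).

Lemma euler_seriesE i f m :
  euler_series i f m = ((mcomb a m - beta) 0 i)%:~R * f m.
Proof. by []. Qed.

Definition sol_series f : Prop :=
  (forall i, euler_series i f = 0) /\
  (forall l, lattice a l -> box_series l f = 0).

Lemma euler_op_denXp i f g : mpsXp p g -> g != 0 ->
  euler_op a beta i (tofrac f / tofrac g) =
  tofrac (euler_series i f) / tofrac g.
Proof.
move=> gp g0; rewrite /euler_op.
under eq_bigr do
  rewrite fderiv_denXp // -(rmorph_int (@tofrac series)) !mulrA -!tofracM.
rewrite -mulr_suml -rmorph_sum -(rmorph_int (@tofrac series)) mulrA -tofracM.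
rewrite -mulrBl -tofracB; congr (tofrac _ / _); apply: mpseriesP => m.
rewrite mpssubE mpssumE mps_intrE [RHS]/= !mxE rmorphB mulrBl; congr (_ - _).
under eq_bigr do rewrite -mulrA mps_intrE mpsX_derivE mulrA.
rewrite -mulr_suml; congr (_ * _); rewrite /mcomb summxE rmorph_sum.
by apply: eq_bigr => j _; rewrite mulmxnE rmorphMn mulr_natr.
Qed.

Lemma box_bar_denXp l f g : mpsXp p g -> g != 0 ->
  box_bar l (tofrac f / tofrac g) = tofrac (box_series l f) / tofrac g.
Proof.
move=> gp g0; rewrite /box_bar /box_series /deriv_pos /deriv_neg !fderivs_denXp //.
by do 2?[case: ifP => // _]; rewrite -mulrBl -tofracB.
Qed.

(** A denominator in F_p[[X^p]] is constant for all the operators, so each acts on the numerator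
    alone. *)
Lemma solA_denXp f g : mpsXp p g -> g != 0 ->
  solA p a beta (tofrac f / tofrac g) <-> sol_series f.
Proof.
move=> gp g0.
have frac0 h : tofrac h / tofrac g = 0 <-> h = 0.
  split=> [/eqP|->]; last by rewrite tofrac0 mul0r.
  by rewrite mulf_eq0 invr_eq0 !tofrac_eq0 (negPf g0) orbF => /eqP.
split=> -[E B]; split=> [i|l /B].
- by apply/frac0; rewrite -euler_op_denXp.
- by rewrite box_bar_denXp // => /frac0.
- by rewrite euler_op_denXp //; apply/frac0.
- by rewrite box_bar_denXp // => /frac0.
Qed.

Lemma sol_series0 : sol_series 0.
Proof.
have d0 k : mpsderivm k 0 = 0 :> series.
  by apply: mpseriesP => m /=; rewrite mulr0.
split=> [i|l _]; first by apply: mpseriesP => m /=; rewrite mulr0.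
by rewrite /box_series !d0 subrr !if_same.
Qed.

Lemma sol_seriesD f g : sol_series f -> sol_series g -> sol_series (f + g).
Proof.
have dD k : mpsderivm k (f + g) = mpsderivm k f + mpsderivm k g.
  by apply: mpseriesP => m /=; rewrite mulrDr.
move=> [Ef Bf] [Eg Bg]; split=> [i|l la].
  rewrite -[RHS]addr0 -{1}(Ef i) -(Eg i).
  by apply: mpseriesP => m /=; rewrite mulrDr.
rewrite -[RHS]addr0 -{1}(Bf l la) -(Bg l la) /box_series !dD.
by do 2?[case: ifP => // _]; rewrite opprD addrACA.
Qed.

(** * Coefficients of a solution *)

Lemma Fp_row_congr gamma :
  (forall i, ((gamma - beta) 0 i)%:~R = 0 :> 'F_p) <->
  exists delta : 'rV[int]_n, gamma = beta + delta *+ p.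
Proof.
split=> [gb|[delta ->] i].
  exists (\row_i (((gamma - beta)%R 0%R i) %/ p)%Z).
  apply/rowP => i; rewrite mxE mulmxnE mxE -[_ *+ p]mulr_natr natz divzK.
    by rewrite !mxE subrKC.
  by rewrite -Fp_intr_eq0 // gb.
by apply/eqP; rewrite Fp_intr_eq0 // addrC addKr mulmxnE -mulr_natr natz dvdz_mull.
Qed.

Lemma mpsderivm_box f w k q : mbox p w ->
  mpsderivm k f (w + q *+ p)%MM =
  (mfact (w + k)%MM)%:R / (mfact w)%:R * f (w + k + q *+ p)%MM.
Proof. by move=> wp; rewrite /= mrise_Fp // mrise_mfactV // -!addmA [(k + _)%MM]addmC. Qed.

Lemma mbox_mmeet u v : mbox p u -> mbox p (mmeet u v).
Proof.
by move=> /mboxP up; apply/mboxP => i; rewrite mnmE (leq_ltn_trans (geq_minl _ _)).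
Qed.

Lemma mfact_neq0 u : mbox p u -> (mfact u)%:R != 0 :> 'F_p.
Proof. by move=> up; rewrite mfact_Fp_eq0 // negbK. Qed.

Lemma sol_series_lt f u v q : sol_series f -> mbox p u ->
  mcomb a v = mcomb a u -> (mdeg v < mdeg u)%N -> f (u + q *+ p)%MM = 0.
Proof.
move=> [_ B] up uv vu; have wp := mbox_mmeet v up.
have := B _ (lattice_ldiff (esym uv)); rewrite /box_series sum_ldiff subr_gt0.
rewrite ltz_nat vu lpos_ldiff.
move=> /(congr1 (fun f : series => f (mmeet u v + q *+ p)%MM)).
rewrite /= -/(mpsderivm _ f _) => /eqP.
rewrite [X in X == _]mpsderivm_box // mmeetl !mulf_eq0 invr_eq0.
by rewrite (negPf (mfact_neq0 up)) (negPf (mfact_neq0 wp)) => /eqP.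
Qed.

(** The two derivatives in the box operator of [u - v] share the invertible factor [1 / min(u, v)!].
    If [v] leaves the box then [v!] is 0 and the coefficient at [u + p q] must vanish; this is where
    goodness comes from. *)
Lemma sol_series_eq f u v q : sol_series f -> mbox p u ->
  mcomb a v = mcomb a u -> mdeg v = mdeg u ->
  (mfact u)%:R * f (u + q *+ p)%MM = (mfact v)%:R * f (v + q *+ p)%MM.
Proof.
move=> [_ B] up uv vu; have wp := mbox_mmeet v up.
have := B _ (lattice_ldiff (esym uv)); rewrite /box_series sum_ldiff vu subrr.
rewrite ltxx lpos_ldiff lneg_ldiff.
move=> /(congr1 (fun f : series => f (mmeet u v + q *+ p)%MM)).
rewrite mpssubE !mpsderivm_box // mmeetl mmeetr => /eqP.
rewrite subr_eq0 ![_ / _ * _]mulrAC => /eqP.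
by apply: mulIf; rewrite invr_eq0 mfact_neq0.
Qed.

(** * The polynomials [Fpoly] and their constant multiples as solutions *)

Lemma mcoeff_Fpoly gamma u :
  (Fpoly p a gamma)@_u = if `[< Umin a gamma u >] then (mfact u)%:R^-1 else 0.
Proof.
rewrite /Fpoly linear_sum /=.
under eq_bigr do rewrite mcoeffZ mcoeffX -natr_prod.
case: asboolP => [gu|Ngu]; last first.
  by rewrite big1 // => v /asboolP gv; case: eqP gv => [->//|_ _]; rewrite mulr0.
have ub : (mdeg u < (weight a gamma).+1)%N by rewrite (proj2 gu).
rewrite (bigD1 (BMultinom ub)) /=; last exact/asboolP.
rewrite eqxx [X in X + _]mulr1 [X in _ + X]big1 ?addr0 // => v /andP[_ vu].
case: eqP => [vE|_]; last by rewrite mulr0.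
by case/eqP: vu; apply: val_inj.
Qed.

Lemma good_mbox gamma u : good p a gamma -> Umin a gamma u -> mbox p u.
Proof.
move=> gg /gg[_ up]; apply/mboxP => i.
by rewrite -(prednK (prime_gt0 p_prime)) ltnS.
Qed.

Lemma Fpoly_mbox gamma m : good p a gamma ->
  mps_of_mpoly (Fpoly p a gamma) m != 0 -> mbox p m.
Proof.
move=> gg /=; rewrite mcoeff_Fpoly; case: asboolP => [gm _|_]; last by rewrite eqxx.
exact: good_mbox gm.
Qed.

Lemma mulXp_Fpoly gamma h w q : good p a gamma -> mpsXp p h -> mbox p w ->
  (h * mps_of_mpoly (Fpoly p a gamma)) (w + q *+ p)%MM =
  h (q *+ p)%MM * (if `[< Umin a gamma w >] then (mfact w)%:R^-1 else 0).
Proof.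
move=> gg hp wp; rewrite mpsXp_mul_box //= ?mcoeff_Fpoly //.
by move=> m; exact: Fpoly_mbox.
Qed.

(** The factor [(w + k)!] of the derivative cancels the denominator in [Fpoly]. If [w + k] leaves
    the box the factor is 0, and by goodness [w + k] is not minimal either. *)
Lemma mpsderivm_mulXp_Fpoly gamma h w k q :
  good p a gamma -> mpsXp p h -> mbox p w ->
  mpsderivm k (h * mps_of_mpoly (Fpoly p a gamma)) (w + q *+ p)%MM =
  h (q *+ p)%MM * (if `[< Umin a gamma (w + k)%MM >] then (mfact w)%:R^-1 else 0).
Proof.
move=> gg hp wp; rewrite mpsderivm_box //.
have [wkp|wkp] := boolP (mbox p (w + k)%MM).
  rewrite mulXp_Fpoly // mulrCA; congr (_ * _).
  by case: asboolP => _; rewrite ?mulr0 // mulrAC divff ?mul1r ?mfact_neq0.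
have /eqP-> : ((mfact (w + k)%MM)%:R : 'F_p) == 0 by rewrite mfact_Fp_eq0.
case: asboolP => [/(good_mbox gg)|_]; first by rewrite (negPf wkp).
by rewrite !mul0r mulr0.
Qed.

(** The exponents [w + lpos l] and [w + lneg l] represent the same vector, and their degrees differ
    by the sum of [l]. The one of larger degree is never minimal; for equal degrees both are minimal
    or neither is. *)
Lemma sol_mulXp_Fpoly gamma h : sigmaA p a beta gamma -> mpsXp p h ->
  sol_series (h * mps_of_mpoly (Fpoly p a gamma)).
Proof.
move=> [gb gNA gg] hp; have p_gt0 := prime_gt0 p_prime.
split=> [i|l la]; apply: mpseriesP => m;
    have [w [q [wp ->]]] := mnm_edivn m p_gt0.
  rewrite euler_seriesE mulXp_Fpoly //.
  case: asboolP => [[gw _]|_]; last by rewrite !mulr0.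
  have /Fp_row_congr/(_ i)-> : exists delta : 'rV[int]_n,
      mcomb a (w + q *+ p)%MM = beta + delta *+ p; last by rewrite mul0r.
  have [delta gE] := gb; exists (delta + mcomb a q).
  by rewrite mcombD mcombMn mulrnDl addrA -gE; congr (_ + _).
have lw := mcomb_lposneg w la; have ld := mdeg_lposneg l w.
rewrite /box_series mps0E -ld subr_gt0 subr_lt0 !ltz_nat.
have Umin_le k k' : mcomb a (w + k)%MM = mcomb a (w + k')%MM ->
    Umin a gamma (w + k)%MM -> (mdeg (w + k)%MM <= mdeg (w + k')%MM)%N.
  move=> kk' [gk ->]; apply: (proj2 (Uplus_weight (_ : Uplus a gamma _))).
  by rewrite /Uplus /= -[LHS]/(mcomb a _) -kk'.
case: ltnP => [lt|le]; last case: ltnP => [lt|ge].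
- rewrite mpsderivm_mulXp_Fpoly //; case: asboolP => [/(Umin_le _ _ lw)|_].
    by rewrite leqNgt lt.
  by rewrite mulr0.
- rewrite mpsderivm_mulXp_Fpoly //; case: asboolP => [/(Umin_le _ _ (esym lw))|_].
    by rewrite leqNgt lt.
  by rewrite mulr0.
- have e : mdeg (w + lpos l)%MM = mdeg (w + lneg l)%MM by apply/eqP; rewrite eqn_leq le.
  rewrite mpssubE !mpsderivm_mulXp_Fpoly //; apply/eqP; rewrite subr_eq0.
  suff -> : Umin a gamma (w + lpos l)%MM = Umin a gamma (w + lneg l)%MM by [].
  rewrite /Umin /Uplus /= -[X in X = gamma]/(mcomb a (w + lpos l)%MM).
  by rewrite -[X in _ = ((X = gamma) /\ _)]/(mcomb a (w + lneg l)%MM) lw e.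
Qed.

(** * Decomposition of an arbitrary solution *)

Lemma sol_series_sigmaA f w q : sol_series f -> mbox p w ->
  f (w + q *+ p)%MM != 0 ->
  sigmaA p a beta (mcomb a w) /\ Umin a (mcomb a w) w.
Proof.
move=> sf wp fw; have [E _] := sf.
(* A minimal [v] of smaller degree than [w] would force the coefficient at [w + p q] to vanish. *)
have min_eq v : Umin a (mcomb a w) v -> mdeg v = mdeg w.
  move=> [gv vE]; apply/eqP; rewrite eqn_leq leqNgt; apply/andP; split; last first.
    rewrite leqNgt; apply: contraNN fw => vw.
    by apply/eqP; exact: (sol_series_lt _ sf wp gv vw).
  by rewrite vE -leqNgt; apply: (proj2 (Uplus_weight (_ : Uplus a _ w))).
have [|[v gv] _] := @Uplus_weight _ _ a (mcomb a w) w; first by [].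
have wmin : Umin a (mcomb a w) w.
  by split=> //; rewrite -(min_eq v gv); case: gv.
split=> //; split; last 1 first.
(* Goodness: a minimal [u] outside the box has [u! = 0], again killing the coefficient at
   [w + p q]. *)
- move=> u gu; have [guw _] := gu; split=> // i.
  rewrite -ltnS prednK ?prime_gt0 //; apply/mboxP; apply: contraNT fw => up.
  have /eqP := sol_series_eq q sf wp guw (min_eq u gu).
  have /eqP-> : ((mfact u)%:R : 'F_p) == 0 by rewrite mfact_Fp_eq0.
  by rewrite mul0r mulf_eq0 (negPf (mfact_neq0 wp)).
- have : exists delta : 'rV[int]_n, mcomb a (w + q *+ p)%MM = beta + delta *+ p.
    apply/Fp_row_congr => i; apply/eqP.
    have /eqP := congr1 (fun f : series => f (w + q *+ p)%MM) (E i).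
    by rewrite /= mulf_eq0 (negPf fw) orbF.
  move=> [delta]; rewrite mcombD mcombMn => e; exists (delta - mcomb a q).
  by rewrite mulrnBl addrA -e addrK.
- by exists w.
Qed.

(** The support of [Fpoly] is nonempty for [gamma] in [sigmaA], and any exponent in it determines
    [gamma]. *)
Lemma Fpoly_inj gamma gamma' : sigmaA p a beta gamma -> sigmaA p a beta gamma' ->
  frac_of_mpoly (Fpoly p a gamma) = frac_of_mpoly (Fpoly p a gamma') ->
  gamma = gamma'.
Proof.
move=> [_ [u _ gu] gg] _ /eqP; rewrite tofrac_eq => /eqP FE.
have [[v gv] _] := Uplus_weight gu.
have := congr1 (fun f : series => f v) FE; rewrite /= !mcoeff_Fpoly.
rewrite (asboolT gv); case: asboolP => [[gv' _] _|_ /eqP].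
  by rewrite -gv'; case: gv => ->.
by rewrite invr_eq0 (negPf (mfact_neq0 (good_mbox gg gv))).
Qed.

Lemma sol_series_decomp f : sol_series f ->
  exists (s : seq 'rV[int]_n) (C : 'rV[int]_n -> series),
    [/\ uniq s, forall gamma, gamma \in s -> sigmaA p a beta gamma,
        forall gamma, mpsXp p (C gamma)
      & f = \sum_(gamma <- s) C gamma * mps_of_mpoly (Fpoly p a gamma)].
Proof.
move=> sf; pose ug gamma := xget 0%MM (Umin a gamma).
(* The common value of [u! f_(u + p q)] over minimal [u], read off at the chosen representative
   [ug gamma] and placed at the exponent [p q]. *)
pose C gamma : series := MPSeries (fun m =>
  if [forall i, (p %| m i)%N] then (mfact (ug gamma))%:R * f (ug gamma + m)%MM else 0).
(* Exponents in the box have degree at most [N * p], so this finite list contains every [gamma] that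
   [f] can involve. *)
pose s := [seq gamma <- undup [seq mcomb a (bmnm t) |
  t <- enum {: 'X_{1..N < (N * p).+1}}] | `[< sigmaA p a beta gamma >]].
have sS gamma : gamma \in s -> sigmaA p a beta gamma.
  by rewrite mem_filter => /andP[/asboolP].
have us : uniq s by rewrite filter_uniq // undup_uniq.
have Cp gamma : mpsXp p (C gamma).
  by move=> m /=; case: ifP => [/forallP//|_]; rewrite eqxx.
exists s, C; split=> //; apply: mpseriesP => m.
have [w [q [wp ->]]] := mnm_edivn m (prime_gt0 p_prime); rewrite mpssumE.
have termE gamma : gamma \in s ->
    (C gamma * mps_of_mpoly (Fpoly p a gamma)) (w + q *+ p)%MM =
    C gamma (q *+ p)%MM * (if `[< Umin a gamma w >] then (mfact w)%:R^-1 else 0).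
  by move=> /sS[_ _ gg]; exact: mulXp_Fpoly.
rewrite (eq_big_seq _ termE).
have term0 gamma : gamma != mcomb a w ->
    C gamma (q *+ p)%MM * (if `[< Umin a gamma w >] then (mfact w)%:R^-1 else 0) = 0.
  move=> gw; case: asboolP => [[gE _]|_]; last by rewrite mulr0.
  by rewrite -gE eqxx in gw.
(* At [w + p q] only the term of [mcomb a w] can contribute; if that vector is not listed, the
   coefficient of [f] is 0 as well. *)
have [ws|ws] := boolP (mcomb a w \in s); last first.
  rewrite big_seq big1 => [|gamma gs]; last first.
    by apply: term0; apply: contraNneq ws => <-.
  apply: contraNeq ws => /(sol_series_sigmaA sf wp)[wS _].
  rewrite mem_filter (asboolT wS) mem_undup /=.
  have wb : (mdeg w < (N * p).+1)%N.
    rewrite ltnS mdegE -[X in (_ <= X * _)%N]card_ord -sum_nat_const.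
    by apply: leq_sum => i _; apply: ltnW; exact/mboxP.
  by apply/mapP; exists (BMultinom wb) => //; rewrite mem_enum.
rewrite (bigD1_seq (mcomb a w)) //= big1 ?addr0 //.
have gug : Umin a (mcomb a w) (ug (mcomb a w)).
  by apply: xgetPex; apply: (proj1 (Uplus_weight (_ : Uplus a _ w))).
have -> : [forall i, (p %| (q *+ p)%MM i)%N].
  by apply/forallP => i; rewrite mulmnE dvdn_mull.
case: asboolP => [gw|Ngw].
  rewrite -(sol_series_eq q sf wp (proj1 gug)); last first.
    by rewrite (proj2 gug) -(proj2 gw).
  by rewrite mulrAC divff ?mul1r ?mfact_neq0.
rewrite mulr0; apply/eqP; apply: contra_notT Ngw.
by move=> /(sol_series_sigmaA sf wp)[].
Qed.

Lemma sum_fracE (T : eqType) (s : seq T) (c phi : T -> {fraction series})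
    (h : T -> series) (F : T -> {mpoly 'F_p[N]}) g :
  (forall b, b \in s -> c b = tofrac (h b) / tofrac g) ->
  (forall b, b \in s -> phi b = frac_of_mpoly (F b)) ->
  \sum_(b <- s) c b * phi b =
  tofrac (\sum_(b <- s) h b * mps_of_mpoly (F b)) / tofrac g.
Proof.
move=> cE phiE; rewrite rmorph_sum mulr_suml; apply: eq_big_seq => b bs.
by rewrite cE // phiE // mulrAC -tofracM.
Qed.

End Solutions.

(** * Independence and spanning over the field of constants *)

Theorem theorem3p1 (p N n : nat) (p_prime : prime p)
    (a : 'I_N -> 'rV[int]_n) (beta : 'rV[int]_n) :
  is_basis (@fracXp p N 'F_p)
    [set frac_of_mpoly (Fpoly p a gamma) | gamma in sigmaA p a beta]
    (solA p a beta).
Proof.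
pose B : set {fraction mpseries N 'F_p} :=
  [set frac_of_mpoly (Fpoly p a gamma) | gamma in sigmaA p a beta].
(* A parameter in [sigmaA] for each [b] in [B]; the default 0 occurs only outside [B]. *)
pose G (b : {fraction mpseries N 'F_p}) := xget 0 [set gamma |
  sigmaA p a beta gamma /\ frac_of_mpoly (Fpoly p a gamma) = b].
have GP b : B b -> sigmaA p a beta (G b) /\ frac_of_mpoly (Fpoly p a (G b)) = b.
  by move=> [gamma gS gE]; apply: (@xgetPex _ 0 [set gamma |
    sigmaA p a beta gamma /\ frac_of_mpoly (Fpoly p a gamma) = b]); exists gamma.
split=> [s c us sB sK|].
  have [h [g [gp g0 hp hE]]] := fracXp_common_den sK.
  rewrite (sum_fracE hE (fun b bs => esym (proj2 (GP b (sB b bs))))) => /eqP.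
  rewrite mulf_eq0 invr_eq0 !tofrac_eq0 (negPf g0) orbF => /eqP sum0 b bs.
  rewrite hE //; suff -> : h b = 0 by rewrite tofrac0 mul0r.
  have [[_ [u _ gu] gg] bE] := GP b (sB b bs).
  have [[v gv] _] := Uplus_weight gu; have vp := good_mbox p_prime gg gv.
  apply: mpseriesP => m; have [//|/eqP hm] := eqVneq (h b m) 0.
  pose q := [multinom (m i %/ p)%N | i < N].
  have mE : m = (q *+ p)%MM.
    by apply/mnmP => i; rewrite mulmnE mnmE divnK //; apply: (hp b bs); exact/eqP.
  (* Since [v] is minimal for [G b], it lies in the support of no other [Fpoly] of the sum: this
     coefficient is [h b] at [p q] divided by [v!]. *)
  have /eqP := congr1 (fun f : mpseries N 'F_p => f (v + q *+ p)%MM) sum0.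
  rewrite mpssumE mps0E (bigD1_seq b bs us) mulXp_Fpoly // ?(asboolT gv); last exact: hp.
  rewrite big_seq_cond big1; last first.
    move=> b' /andP[bs' bb']; have [[gb' gNA' gg'] bE'] := GP b' (sB b' bs').
    rewrite mulXp_Fpoly //; last exact: hp.
    case: asboolP => [[gv' _]|_]; last by rewrite mulr0.
    by case/eqP: bb'; rewrite -bE -bE' -gv'; case: gv => ->.
  rewrite /= addr0 mulf_eq0 invr_eq0 (negPf (mfact_neq0 p_prime vp)) orbF -mE => /eqP.
  by move=> hm0; case: hm.
apply/seteqP; split=> [x|x [s [c [us sB sK ->]]]].
  have [f [g [gp g0 ->]]] := frac_denXp p_prime x.
  move=> /(solA_denXp _ _ p_prime _ gp g0)/(sol_series_decomp p_prime).
  move=> [s [C [us sS Cp ->]]].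
  rewrite -(@sum_fracE p N _ s (fun gamma => tofrac (C gamma) / tofrac g)
    (fun gamma => frac_of_mpoly (Fpoly p a gamma))) //.
  apply: lin_span_image => //; first by move=> y z yS zS; exact: (Fpoly_inj p_prime yS zS).
  by move=> gamma _; exists (C gamma), g.
(* Conversely, over a common denominator a combination has as numerator a sum of solutions
   [h * Fpoly]. *)
have [h [g [gp g0 hp hE]]] := fracXp_common_den sK.
rewrite (sum_fracE hE (fun b bs => esym (proj2 (GP b (sB b bs))))).
apply/solA_denXp => //; rewrite big_seq.
apply: (big_ind (@sol_series p N n a beta)) => [|f f'|b bs].
- exact: sol_series0.
- exact: sol_seriesD.
- by apply: sol_mulXp_Fpoly => //; [case: (GP b (sB b bs))|exact: hp].
Qed.
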